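(* Let $\mathbb{F}$ be a finite field, let $\mathcal{C}\subseteq\mathbb{F}^n$ be a $k$-dimensional linear code with support $\mathcal{I}=\{0,\ldots,n-1\}$ and parity check matrix $H\in\mathbb{F}^{(n-k)\times n}$. Let $(X,\mathcal{T})$ be a characteristic pair of $\mathcal{C}$. Let $G\in\mathbb{F}^{k\times n}$ consist of $k$ linearly independent rows of $X$ and let $\mathcal{S}$ be the list of the corresponding spans taken from $\mathcal{T}$. Then the trellises $T_{G,\mathcal{S}}$ and $T_{(G,H,\mathcal{S})}$ are isomorphic. As a consequence, every $\mathrm{KV}$-trellis of $\mathcal{C}$ is (up to isomorphism) a BCJR-trellis and thus non-mergeable.
   Context: Trellises. A (tail-biting) trellis $T=(V,E)$ of depth $n$ over $\mathbb{F}$ has a vertex set that is the disjoint union $V=V_0\cup\ldots\cup V_{n-1}$ and edge sets $E_i\subseteq V_i\times\mathbb{F}\times V_{i+1}$ for $i\in\mathcal{I}=\{0,\ldots,n-1\}$ (time indices are always taken modulo $n$); $(v,a,w)\in E_i$ is an edge from $v$ to $w$ with label $a$. A cycle is a closed path of length $n$ starting and ending at the same vertex of $V_0$. The edge-label code $\mathcal{C}(T)\subseteq\mathbb{F}^n$ is the set of label sequences of all cycles of $T$; $T$ represents $\mathcal{C}$ if $\mathcal{C}(T)=\mathcal{C}$. Trellises $T,T'$ whose vertex sets $V_i,V_i'$ are $\mathbb{F}$-vector spaces (as all those below) are isomorphic if there are vector space isomorphisms $\phi_i:V_i\to V_i'$, $i\in\mathcal{I}$, such that $(v,a,w)\in E_i\Leftrightarrow(\phi_i(v),a,\phi_{i+1}(w))\in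 E_i'$. Non-mergeable. A trellis $T$ representing $\mathcal{C}$ is non-mergeable if for every $i\in\mathcal{I}$ and any two distinct vertices $v_1,v_2\in V_i$, merging them yields a trellis that does not represent $\mathcal{C}$. Merging means replacing $v_1,v_2$ by a single vertex $\hat v$ at time $i$, replacing each edge $(v_j,a,w)\in E_i$ by $(\hat v,a,w)$ and each edge $(w,a,v_j)\in E_{i-1}$ by $(w,a,\hat v)$, $j=1,2$. Spans. For $a,b\in\mathcal{I}$ put $[a,b]=\{a,\ldots,b\}$ if $a\le b$ and $[a,b]=\{a,\ldots,n-1,0,\ldots,b\}$ if $a>b$, and $(a,b]=[a,b]\setminus\{a\}$. The interval $(a,b]$ is a span of a nonzero vector $c\in\mathbb{F}^n$ (coordinates indexed by $\mathcal{I}$) if $c_a\ne0\ne c_b$ and $c_j=0$ for $j\notin[a,b]$ (intervals are recorded by their endpoints $a,b$). A span list for $G\in\mathbb{F}^{k\times n}$ is a list $\mathcal{S}=[(a_l,b_l],\,l=1,\ldots,k]$ where $(a_l,b_l]$ is a span of the $l$-th row of $G$. Product trellis. For $G$ with columns $G_0,\ldots,G_{n-1}$ and span list $\mathcal{S}$, let $M_i\in\mathbb{F}^{k\times k}$ be the diagonal matrix whose $l$-th diagonal entry is $1$ if $i\in(a_l,b_l]$ and $0$ otherwise. The product trellis $T_{G,\mathcal{S}}$ has vertex spaces $\{\alpha M_i\mid\alpha\in\mathbb{F}^k\}$ and edge spaces $\{(\alpha M_i,\alpha G_i,\alpha M_{i+1})\mid\alpha\in\mathbb{F}^k\}$, $i\in\mathcal{I}$.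 BCJR-trellis. Let $G=(g_{lj})\in\mathbb{F}^{k\times n}$ be a generator matrix of $\mathcal{C}$ with span list $\mathcal{S}$, and let $H_0,\ldots,H_{n-1}\in\mathbb{F}^{n-k}$ be the rows of $H^{\sf T}$, where $\mathcal{C}=\{c\in\mathbb{F}^n\mid cH^{\sf T}=0\}$. Let $N_0\in\mathbb{F}^{k\times(n-k)}$ be the matrix with rows $\sum_{j=a_l}^{n-1}g_{lj}H_j$, $l=1,\ldots,k$, and $N_i=N_{i-1}+G_{i-1}H_{i-1}$ (column times row) for $i=1,\ldots,n$; then $N_n=N_0$. The BCJR-trellis $T_{(G,H,\mathcal{S})}$ has vertex spaces $\{\alpha N_i\mid\alpha\in\mathbb{F}^k\}$ and edge spaces $\{(\alpha N_i,\alpha G_i,\alpha N_{i+1})\mid\alpha\in\mathbb{F}^k\}$. It is known that both $T_{G,\mathcal{S}}$ and $T_{(G,H,\mathcal{S})}$ represent $\mathcal{C}$. Characteristic pair. A characteristic pair of $\mathcal{C}$ is a pair $(X,\mathcal{T})$ where $X\in\mathbb{F}^{n\times n}$ has rows $x_1,\ldots,x_n$ and $\mathcal{T}=[(a_l,b_l],\,l=1,\ldots,n]$ such that: (i) $x_1,\ldots,x_n$ generate $\mathcal{C}$; (ii) $(a_l,b_l]$ is a span of $x_l$ for each $l$; (iii) $a_1,\ldots,a_n$ are distinct and $b_1,\ldots,b_n$ are distinct; (iv) for each $j\in\mathcal{I}$ there are exactly $n-k$ indices $l$ with $j\in(a_l,b_l]$. A $\mathrm{KV}$-trellis of $\mathcal{C}$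 is a product trellis $T_{G,\mathcal{S}}$ where, for some characteristic pair $(X,\mathcal{T})$ of $\mathcal{C}$, $G$ consists of $k$ linearly independent rows of $X$ and $\mathcal{S}$ consists of the corresponding spans from $\mathcal{T}$. *)

(* Defs.v *)
From mathcomp Require Import all_boot all_order all_algebra.

Set Implicit Arguments.
Unset Strict Implicit.
Unset Printing Implicit Defensive.

Import GRing.Theory.
Local Open Scope ring_scope.

(* Time indices are elements of 'I_n; [ordS i] is i + 1 modulo n. *)

Record trellis (F : fieldType) (n : nat) := Trellis {
  vertex : 'I_n -> eqType;
  edge : forall i : 'I_n, vertex i -> F -> vertex (ordS i) -> Prop
}.

Record lin_trellis (F : fieldType) (n : nat) := LinTrellis {
  vspc : 'I_n -> vectType F;
  ledge : forall i : 'I_n, vspc i -> F -> vspc (ordS i) -> Prop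
}.

Definition trellis_of_lin (F : fieldType) (n : nat) (T : lin_trellis F n) :
    trellis F n :=
  @Trellis F n (fun i => vspc T i) (fun i v a w => ledge v a w).

Coercion trellis_of_lin : lin_trellis >-> trellis.

(* A cycle is given by its vertices v_0, ..., v_(n-1); it closes up at v_0
   because ordS wraps around. *)
Definition label_code (F : fieldType) (n : nat) (T : trellis F n)
    (c : 'rV[F]_n) : Prop :=
  exists v : forall i : 'I_n, vertex T i,
    forall i : 'I_n, edge (v i) (c 0 i) (v (ordS i)).

Definition represents (F : fieldType) (n : nat) (T : trellis F n)
    (C : {vspace 'rV[F]_n}) : Prop :=
  forall c : 'rV[F]_n, label_code T c <-> c \in C.

Definition trellis_iso (F : fieldType) (n : nat) (T T' : lin_trellis F n) :
    Prop :=
  exists phi : forall i : 'I_n, {linear vspc T i -> vspc T' i},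
    (forall i, bijective (phi i)) /\
    (forall (i : 'I_n) (v : vspc T i) (a : F) (w : vspc T (ordS i)),
       ledge v a w <-> ledge (phi i v) a (phi (ordS i) w)).

Section Merging.
Variables (F : fieldType) (n : nat) (T : trellis F n).
Variables (i : 'I_n) (v1 v2 : vertex T i).

(* [Tagged] records a vertex together with its time, so that vertices at time
   j can be compared with v1 and v2 without a cast along j = i. *)
Definition is_v12 (j : 'I_n) (v : vertex T j) : bool :=
  (Tagged (vertex T) v == Tagged (vertex T) v1)
  || (Tagged (vertex T) v == Tagged (vertex T) v2).

(* After merging: the new vertex v^ (at time i only), and all vertices other
   than v1 and v2. *)
Definition merged_vertex (j : 'I_n) : eqType :=
  ({_ : unit | j == i} + {v : vertex T j | ~~ is_v12 v})%type.

Definition replaced_by (j : 'I_n) (v : vertex T j) (x : merged_vertex j) :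
    Prop :=
  match x with
  | inl _ => is_v12 v
  | inr u => v = sval u
  end.

Definition merged_edge (j : 'I_n) (x : merged_vertex j) (a : F)
    (y : merged_vertex (ordS j)) : Prop :=
  exists (v : vertex T j) (w : vertex T (ordS j)),
    [/\ replaced_by v x, replaced_by w y & edge v a w].

Definition merge : trellis F n := Trellis merged_edge.

End Merging.

Definition non_mergeable (F : fieldType) (n : nat) (C : {vspace 'rV[F]_n})
    (T : trellis F n) : Prop :=
  represents T C /\
  forall (i : 'I_n) (v1 v2 : vertex T i),
    v1 <> v2 -> ~ represents (merge v1 v2) C.

(* The pair (a, b) of endpoints encodes both [a, b] and (a, b]. *)
Definition in_cc (n : nat) (s : 'I_n * 'I_n) (j : 'I_n) : bool :=
  if (s.1 <= s.2)%N then (s.1 <= j <= s.2)%N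
  else (s.1 <= j)%N || (j <= s.2)%N.

Definition in_oc (n : nat) (s : 'I_n * 'I_n) (j : 'I_n) : bool :=
  in_cc s j && (j != s.1).

Definition is_span (F : fieldType) (n : nat) (s : 'I_n * 'I_n)
    (c : 'rV[F]_n) : Prop :=
  [/\ c 0 s.1 != 0, c 0 s.2 != 0 & forall j, ~~ in_cc s j -> c 0 j = 0].

Definition span_list (F : fieldType) (k n : nat) (G : 'M[F]_(k, n))
    (S : 'I_k -> 'I_n * 'I_n) : Prop :=
  forall l, is_span (S l) (row l G).

(* The trellis with vertex spaces {alpha M_i} and edge spaces
   {(alpha M_i, alpha G_i, alpha M_(i+1))}. *)
Definition mx_vspace (F : fieldType) (k m : nat) (M : 'M[F]_(k, m)) :
    {vspace 'rV[F]_m} :=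
  limg (linfun (mulmxr M : 'rV[F]_k -> 'rV[F]_m)).

Definition mx_trellis (F : fieldType) (k n m : nat) (G : 'M[F]_(k, n))
    (M : 'I_n -> 'M[F]_(k, m)) : lin_trellis F n :=
  @LinTrellis F n (fun i => subvs_of (mx_vspace (M i)))
    (fun i v a w => exists alpha : 'rV[F]_k,
       [/\ vsval v = alpha *m M i,
           a = (alpha *m col i G) 0 0
         & vsval w = alpha *m M (ordS i)]).

Definition span_mx (F : fieldType) (k n : nat) (S : 'I_k -> 'I_n * 'I_n)
    (i : 'I_n) : 'M[F]_k :=
  diag_mx (\row_l (in_oc (S l) i)%:R).

Definition product_trellis (F : fieldType) (k n : nat) (G : 'M[F]_(k, n))
    (S : 'I_k -> 'I_n * 'I_n) : lin_trellis F n :=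
  mx_trellis G (fun i => span_mx F S i).

Definition bcjr_mx0 (F : fieldType) (k n r : nat) (G : 'M[F]_(k, n))
    (H : 'M[F]_(r, n)) (S : 'I_k -> 'I_n * 'I_n) : 'M[F]_(k, r) :=
  \matrix_(l < k) \sum_(j < n | ((S l).1 <= j)%N) G l j *: row j H^T.

(* N_i with the recursion N_i = N_(i-1) + G_(i-1) H_(i-1) summed up. *)
Definition bcjr_mx (F : fieldType) (k n r : nat) (G : 'M[F]_(k, n))
    (H : 'M[F]_(r, n)) (S : 'I_k -> 'I_n * 'I_n) (i : nat) : 'M[F]_(k, r) :=
  bcjr_mx0 G H S + \sum_(j < n | (j < i)%N) col j G *m row j H^T.

(* The edges at time n - 1 end in the space of N_0, which is N_n when the rows
   of G lie in the kernel of H^T. *)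
Definition bcjr_trellis (F : fieldType) (k n r : nat) (G : 'M[F]_(k, n))
    (H : 'M[F]_(r, n)) (S : 'I_k -> 'I_n * 'I_n) : lin_trellis F n :=
  mx_trellis G (fun i => bcjr_mx G H S i).

Definition full_support (F : fieldType) (n : nat) (C : {vspace 'rV[F]_n}) :
    Prop :=
  forall j : 'I_n, exists2 c : 'rV[F]_n, c \in C & c 0 j != 0.

Definition parity_check (F : fieldType) (n r : nat) (C : {vspace 'rV[F]_n})
    (H : 'M[F]_(r, n)) : Prop :=
  forall c : 'rV[F]_n, c \in C <-> c *m H^T = 0.

Definition generator_mx (F : fieldType) (k n : nat) (C : {vspace 'rV[F]_n})
    (G : 'M[F]_(k, n)) : Prop :=
  basis_of C [seq row l G | l : 'I_k].

Definition characteristic_pair (F : fieldType) (n : nat)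
    (C : {vspace 'rV[F]_n}) (X : 'M[F]_n) (S : 'I_n -> 'I_n * 'I_n) : Prop :=
  [/\ <<[seq row l X | l : 'I_n]>>%VS = C,
      span_list X S,
      injective (fun l => (S l).1) /\ injective (fun l => (S l).2)
    & forall j : 'I_n, #|[set l | in_oc (S l) j]| = (n - \dim C)%N].

Definition KV_trellis (F : fieldType) (n : nat) (C : {vspace 'rV[F]_n})
    (T : lin_trellis F n) : Prop :=
  exists (X : 'M[F]_n) (S : 'I_n -> 'I_n * 'I_n) (f : 'I_(\dim C) -> 'I_n),
    [/\ characteristic_pair C X S,
        row_free (rowsub f X)
      & T = product_trellis (rowsub f X) (fun l => S (f l))].

Definition BCJR_trellis (F : fieldType) (n : nat) (C : {vspace 'rV[F]_n})
    (T : lin_trellis F n) : Prop :=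
  exists (G : 'M[F]_(\dim C, n)) (H : 'M[F]_(n - \dim C, n))
         (S : 'I_(\dim C) -> 'I_n * 'I_n),
    [/\ generator_mx C G, parity_check C H, span_list G S
      & T = bcjr_trellis G H S].

(* Main.v *)
Require Import Defs.
From mathcomp Require Import all_boot all_order all_algebra zify.

Set Implicit Arguments.
Unset Strict Implicit.
Unset Printing Implicit Defensive.
Import GRing.Theory.
Local Open Scope ring_scope.

(* Write y_(l,i) for row x_l of X cut down to the cyclic interval [a_l, i), which
   is all of x_l when i lies outside (a_l, b_l].  Then N_i = Y_i H^T.  The starts
   a_l being distinct, Y_i is triangular with respect to the cyclic order
   beginning at i, hence invertible, and N_i has rank n - k.  Only the n - k rows
   active at time i are nonzero in N_i, so they are independent: M_i and N_i have
   the same kernel, and so they do after restriction to the rows of G.  This is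
   the isomorphism.  Non-mergeability: going once around the product trellis one
   can walk from any vertex alpha M_i to any other vertex beta M_i, and the
   labels read off have syndrome (beta - alpha) N_i, which is nonzero. *)

(** * Trellises presented by matrices, and isomorphisms between them *)

Lemma mx_vspaceP (F : fieldType) (k m : nat) (M : 'M[F]_(k, m)) (v : 'rV_m) :
  reflect (exists alpha, v = alpha *m M) (v \in mx_vspace M).
Proof.
apply: (iffP memv_imgP) => [[u _ ->]|[u ->]]; exists u; by rewrite ?memvf ?lfunE.
Qed.

Lemma mem_mx_vspace (F : fieldType) (k m : nat) (M : 'M[F]_(k, m)) alpha :
  alpha *m M \in mx_vspace M.
Proof. by apply/mx_vspaceP; exists alpha. Qed.

Definition mx_vertex (F : fieldType) (k m : nat) (M : 'M[F]_(k, m))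
    (alpha : 'rV[F]_k) : subvs_of (mx_vspace M) :=
  vsproj (mx_vspace M) (alpha *m M).

Lemma mx_vertexE (F : fieldType) (k m : nat) (M : 'M[F]_(k, m)) alpha :
  vsval (mx_vertex M alpha) = alpha *m M.
Proof. by rewrite vsprojK ?mem_mx_vspace. Qed.

Lemma mx_vertex_ex (F : fieldType) (k m : nat) (M : 'M[F]_(k, m))
  (v : subvs_of (mx_vspace M)) : exists alpha, v = mx_vertex M alpha.
Proof.
have /mx_vspaceP[alpha va] := subvsP v.
by exists alpha; apply: val_inj; rewrite /= mx_vertexE -va.
Qed.

Section SameKernel.
Variables (F : fieldType) (k m m' : nat) (M : 'M[F]_(k, m)) (N : 'M[F]_(k, m')).

(** [pinvmx M] picks one coefficient row [alpha] of a vertex [alpha *m M]; the image is independent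
    of this choice once the kernel of [M] lies in that of [N]. *)
Definition mx_transfer :
    {linear subvs_of (mx_vspace M) -> subvs_of (mx_vspace N)} :=
  vsproj (mx_vspace N) \o mulmxr (pinvmx M *m N) \o vsval.

Lemma mx_transferE : (forall alpha : 'rV_k, alpha *m M = 0 -> alpha *m N = 0) ->
  forall alpha, mx_transfer (mx_vertex M alpha) = mx_vertex N alpha.
Proof.
move=> ker alpha; rewrite /mx_transfer /= mx_vertexE /mx_vertex.
congr (vsproj _ _).
rewrite mulmxA; apply/eqP; rewrite -subr_eq0 -mulmxBl; apply/eqP/ker.
by rewrite mulmxBl mulmxKpV ?subrr // submxMl.
Qed.
End SameKernel.

Lemma mx_trellis_iso (F : fieldType) (k n m m' : nat) (G : 'M[F]_(k, n))
  (M : 'I_n -> 'M_(k, m)) (N : 'I_n -> 'M_(k, m')) :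
  (forall i (alpha : 'rV_k), alpha *m M i = 0 <-> alpha *m N i = 0) ->
  trellis_iso (mx_trellis G M) (mx_trellis G N).
Proof.
move=> ker.
have MN i : cancel (mx_transfer (M i) (N i)) (mx_transfer (N i) (M i)).
  move=> v; have [alpha ->] := mx_vertex_ex v.
  by rewrite !mx_transferE // => ? /ker.
have NM i : cancel (mx_transfer (N i) (M i)) (mx_transfer (M i) (N i)).
  move=> v; have [alpha ->] := mx_vertex_ex v.
  by rewrite !mx_transferE // => ? /ker.
exists (fun i => mx_transfer (M i) (N i)); split=> [i|i v a w].
  exact: Bijective (MN i) (NM i).
have val_iff j (u : subvs_of (mx_vspace (M j))) alpha :
    vsval u = alpha *m M j <-> vsval (mx_transfer (M j) (N j) u) = alpha *m N j.
  rewrite -!mx_vertexE; split=> [/val_inj->|/val_inj uN].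
    by rewrite mx_transferE // => ? /ker.
  by rewrite -[u](MN j) uN mx_transferE // => ? /ker.
by split=> /= -[alpha [/val_iff va -> /val_iff wa]]; exists alpha.
Qed.

(* Membership in the cyclic interval [a, i), read as the full circle if a = i. *)
Definition in_co (a i j : nat) : bool :=
  if (a < i)%N then (a <= j < i)%N else (a <= j)%N || (j < i)%N.

(** * BCJR matrices as syndromes of truncated rows *)

Section Truncation.
Variables (F : fieldType) (k n r : nat) (G : 'M[F]_(k, n)) (H : 'M[F]_(r, n)).
Variable S : 'I_k -> 'I_n * 'I_n.

Definition trunc_mx (i : nat) : 'M[F]_(k, n) :=
  \matrix_(l, j) (G l j *+ in_co (S l).1 i j).

Hypothesis GH : G *m H^T = 0.

Lemma bcjr_trunc (i : nat) : bcjr_mx G H S i = trunc_mx i *m H^T.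
Proof.
apply/matrixP=> l t; rewrite !mxE !summxE.
rewrite big_mkcond /= [X in _ + X]big_mkcond /=.
have G0 : \sum_j G l j * H t j = 0.
  have /matrixP/(_ l t) := GH; rewrite !mxE => {2}<-.
  by apply: eq_bigr => j _; rewrite !mxE.
(* For a_l < i the two sums on the left cover the full circle once and
   [a_l, i) once more; z is the vanishing sum over the full circle. *)
pose z := if ((S l).1 < i)%N then \sum_j G l j * H t j else 0.
rewrite -[RHS]addr0 -[X in _ = _ + X](_ : z = 0);
  last by rewrite /z G0; case: ifP.
rewrite /z -big_split; case: ifP => ai.
  rewrite -big_split; apply: eq_bigr => j _ /=.
  rewrite !mxE big_ord1 !mxE /in_co ai.
  case: (leqP (S l).1 j) => aj; case: (ltnP j i) => ji;
    rewrite /= ?mulr1n ?mulr0n ?mul0r ?addr0 ?add0r //.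
  by lia.
rewrite addr0; apply: eq_bigr => j _ /=.
rewrite !mxE big_ord1 !mxE /in_co ai.
case: (leqP (S l).1 j) => aj; case: (ltnP j i) => ji;
    rewrite /= ?mulr1n ?mulr0n ?mul0r ?addr0 ?add0r //.
by lia.
Qed.

Lemma bcjr_step (j : 'I_n) :
  bcjr_mx G H S (ordS j) = bcjr_mx G H S j + col j G *m row j H^T.
Proof.
have -> : bcjr_mx G H S (ordS j) = bcjr_mx G H S j.+1.
  rewrite /=; case: (ltnP j.+1 n) => [jn|nj]; first by rewrite modn_small.
  (* At the wrap-around N_n = N_0: cutting at n or at 0 keeps the same coordinates, those from a_l
     on. *)
  have -> : j.+1 = n by apply/eqP; rewrite eqn_leq nj ltn_ord.
  rewrite modnn !bcjr_trunc; congr (_ *m _); apply/matrixP=> l t; rewrite !mxE.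
  by rewrite /in_co ltn_ord ltn0 ltn_ord andbT orbF.
rewrite /bcjr_mx -addrA; congr (_ + _).
rewrite (bigD1 j) ?ltnS //= addrC; congr (_ + _).
by apply: eq_bigl => t; rewrite ltnS [in RHS]ltn_neqAle andbC.
Qed.

Lemma span_mxE (alpha : 'rV[F]_k) i l :
  (alpha *m span_mx F S i) 0 l = alpha 0 l *+ in_oc (S l) i.
Proof. by rewrite mul_mx_diag !mxE mulr_natr. Qed.

Hypothesis GS : span_list G S.

(* Off the span, the cyclic interval [a_l, i) contains the whole support of
   row l, whose syndrome vanishes. *)
Lemma bcjr_span_mx (i : 'I_n) :
  span_mx F S i *m bcjr_mx G H S i = bcjr_mx G H S i.
Proof.
rewrite bcjr_trunc mulmxA; apply/row_matrixP=> l; rewrite !row_mul.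
have -> : row l (span_mx F S i) *m trunc_mx i =
    row l (trunc_mx i) *+ in_oc (S l) i.
  apply/rowP=> j; rewrite -row_mul mxE mul_diag_mx !mxE.
  by case: in_oc; rewrite ?mul1r ?mul0r ?mulr1n ?mxE.
case: (boolP (in_oc (S l) i)) => [_|out]; first by rewrite mulr1n.
rewrite mulr0n mul0mx; have [_ _ G0] := GS l.
suff -> : row l (trunc_mx i) = row l G by rewrite -row_mul GH row0.
apply/rowP=> j; rewrite !mxE; case: (boolP (in_co _ _ _)) => // Nco.
have := G0 j; rewrite mxE mulr0n => -> //.
move: out Nco; rewrite /in_oc /in_cc /in_co -[i == _]val_eqE /=.
by repeat case: ifP; lia.
Qed.

(* The right-hand side telescopes around the circle when consecutive alpha_j
   agree as vertices. *)
Lemma syndrome_walk (alpha : 'I_n -> 'rV[F]_k) (c : 'rV[F]_n) :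
  (forall j, c 0 j = (alpha j *m col j G) 0 0) ->
  c *m H^T = \sum_j (alpha j *m span_mx F S (ordS j) *m bcjr_mx G H S (ordS j) -
                      alpha j *m span_mx F S j *m bcjr_mx G H S j).
Proof.
move=> cE; rewrite mulmx_sum_row; apply: eq_bigr => j _.
rewrite -!mulmxA !bcjr_span_mx bcjr_step mulmxDr addrC addrA addNr add0r mulmxA.
by rewrite [alpha j *m _]mx11_scalar -cE mul_scalar_mx.
Qed.
End Truncation.

(** * Kernels for a characteristic pair *)

Section CharacteristicPair.
Variables (F : fieldType) (n : nat) (C : {vspace 'rV[F]_n}).
Variables (X : 'M[F]_n) (S : 'I_n -> 'I_n * 'I_n) (H : 'M[F]_(n - \dim C, n)).
Hypothesis (XS : characteristic_pair C X S) (HC : parity_check C H).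

(* Ordered cyclically from i on, the truncated rows have distinct leading
   positions (S l).1. *)
Lemma trunc_mx_row_full (i : 'I_n) : row_full (trunc_mx X S i).
Proof.
have [_ XSp [inj1 _] _] := XS.
have spn l : X l (S l).1 != 0 by have [] := XSp l; rewrite mxE.
(* [rho j] is the position of [j] in the cyclic order beginning at [i]. *)
pose rho (j : nat) := if (i <= j)%N then (j - i)%N else (j + n - i)%N.
have rhoP (a j : 'I_n) : in_co a i j -> (rho a <= rho j)%N.
  rewrite /in_co /rho; have := ltn_ord a; have := ltn_ord i; have := ltn_ord j.
  by repeat case: ifP; lia.
have rho_inj (a j : 'I_n) : rho a = rho j -> a = j.
  rewrite /rho => E; apply/val_inj => /=; move: E.
  have := ltn_ord a; have := ltn_ord i; have := ltn_ord j.
  by repeat case: ifP; lia.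
rewrite -[row_full _]/(row_free _) -kermx_eq0.
apply/rowV0P => beta /sub_kermxP betaY.
suff beta0 m l : (rho (S l).1 < m)%N -> beta 0 l = 0.
  by apply/rowP=> l; rewrite mxE (beta0 (rho (S l).1).+1).
elim: m l => // m IHm l; rewrite ltnS => lm.
(* At coordinate a_l, rows starting later vanish and rows starting earlier have coefficient 0 by
   induction; only [beta 0 l] times a nonzero entry remains. *)
have := congr1 (fun u : 'rV_n => u 0 (S l).1) betaY.
rewrite !mxE (bigD1 l) //= big1 ?addr0 => [|l' l'l].
  rewrite mxE (_ : in_co _ _ _) => [/eqP|].
    by rewrite mulf_eq0 (negPf (spn l)) orbF => /eqP.
  by rewrite /in_co; case: ifP; lia.
rewrite mxE; case: (boolP (in_co _ _ _)) => [/rhoP le|_];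
  last by rewrite mulr0n mulr0.
rewrite IHm ?mul0r //; apply: leq_trans lm; rewrite ltn_neqAle le andbT.
by apply: contra_neq l'l => /rho_inj/inj1.
Qed.

(** Rank-nullity: the syndrome map has kernel C, so its image has dimension n - dim C, that of the
    whole target. *)
Lemma parity_check_row_full : row_full H^T.
Proof.
pose h : 'Hom('rV[F]_n, 'rV[F]_(n - \dim C)) := linfun (mulmxr H^T).
have hC : (fullv :&: lker h)%VS = C.
  rewrite capfv; apply/vspaceP => c; rewrite memv_ker lfunE /=.
  by apply/eqP/idP => /HC.
have := limg_ker_dim h fullv; rewrite hC => dimh.
have dim_rV m : \dim {: 'rV[F]_m} = m by rewrite dimvf /dim /= mul1n.
have h_full : limg h = fullv.
  apply/eqP; rewrite eqEdim subvf /= dim_rV.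
  by rewrite -(addKn (\dim C) (\dim (limg h))) dimh dim_rV.
rewrite -sub1mx; apply/row_subP => t.
have /memv_imgP[u _ ->] : row t 1%:M \in limg h by rewrite h_full memvf.
by rewrite lfunE /= submxMl.
Qed.

Lemma char_pair_syndrome0 : X *m H^T = 0.
Proof.
have [XC _ _ _] := XS.
apply/row_matrixP=> l; rewrite row_mul row0; apply/HC.
by rewrite -XC memv_span //; apply/imageP; exists l.
Qed.

(* The n - dim C rows of the BCJR matrix that are active at time i already have
   to span its row space, so they are independent. *)
Lemma char_pair_ker (i : 'I_n) (beta : 'rV_n) :
  beta *m bcjr_mx X H S i = 0 -> beta *m span_mx F S i = 0.
Proof.
have [_ XSp _ cnt] := XS; have XH := char_pair_syndrome0.
set N := bcjr_mx X H S i; pose A := [set l | in_oc (S l) i].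
(* [P] selects the active rows, so M_i = P^T P and N_i = P^T (P N_i). Once [P *m N] is free, beta
   N_i = 0 forces beta P^T = 0. *)
pose P : 'M[F]_(#|A|, n) := rowsub enum_val 1%:M.
have DP : span_mx F S i = P^T *m P.
  apply/matrixP=> l m; rewrite !mxE.
  under [RHS]eq_bigr do rewrite !mxE.
  rewrite -(big_enum_val (fun x => (x == l)%:R * (x == m)%:R)) /=.
  rewrite big_mkcond (bigD1 l) //= big1 ?addr0 => [|x /negPf->]; last first.
    by rewrite mul0r if_same.
  by rewrite inE eqxx mul1r; case: in_oc; rewrite ?mul0rn.
have NE : span_mx F S i *m N = N by exact: bcjr_span_mx.
have N_full : row_full N.
  rewrite /row_full /N (bcjr_trunc _ XH) (eqmxMfull _ (trunc_mx_row_full i)).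
  exact: parity_check_row_full.
have PN_free : row_free (P *m N).
  rewrite /row_free eqn_leq rank_leq_row.
  have le : (\rank N <= \rank (P *m N))%N.
    by rewrite -{1}NE DP -mulmxA mxrankM_maxr.
  by apply: leq_trans le; rewrite (eqP N_full) (cnt i).
rewrite -NE DP -!mulmxA mulmxA -(mul0mx _ (P *m N)).
by move=> /(row_free_inj PN_free); rewrite mulmxA => ->; rewrite mul0mx.
Qed.
End CharacteristicPair.

(** * Product trellises: represented code and non-mergeability *)

Lemma generator_syndrome0 (F : fieldType) (k n r : nat) (C : {vspace 'rV[F]_n})
    (G : 'M[F]_(k, n)) (H : 'M[F]_(r, n)) :
  mx_vspace G = C -> parity_check C H -> G *m H^T = 0.
Proof.
move=> GC HC; apply/row_matrixP=> l; rewrite row_mul row0; apply/HC.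
by rewrite -GC rowE mem_mx_vspace.
Qed.

Section ProductTrellis.
Variables (F : fieldType) (k n r : nat) (C : {vspace 'rV[F]_n}).
Variables (G : 'M[F]_(k, n)) (H : 'M[F]_(r, n)) (S : 'I_k -> 'I_n * 'I_n).
Hypotheses (GC : mx_vspace G = C) (HC : parity_check C H) (GS : span_list G S).

Let GH : G *m H^T = 0 := generator_syndrome0 GC HC.

(** Coefficient rows may vary along a cycle, but consecutive ones give the same vertex, so the
    syndrome telescopes to 0. Conversely, a constant [alpha] reads off the codeword [alpha *m G]. *)
Lemma product_trellis_represents : represents (product_trellis G S) C.
Proof.
move=> c; split=> [[v /fin_all_exists[alpha walk]]|].
  apply/HC; rewrite (syndrome_walk GH GS (alpha := alpha)) => [|j]; last first.
    by have [] := walk j.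
  under eq_bigr => j _ do have [<- _ <-] := walk j.
  by rewrite sumrB [X in _ - X](reindex_inj (@ordS_inj n)) subrr.
rewrite -GC => /mx_vspaceP[alpha ->].
exists (fun j => mx_vertex (span_mx F S j) alpha) => j; exists alpha.
split; rewrite ?mx_vertexE //.
by rewrite !mxE; apply: eq_bigr => l _; rewrite mxE.
Qed.

(* Every row is inactive at its own starting time, where its coefficient can
   therefore be switched from alpha to beta: this walks once around the trellis
   from the vertex of alpha at time i to that of beta. *)
Definition switch (i : 'I_n) (alpha beta : 'rV[F]_k) (j : 'I_n) : 'rV[F]_k :=
  \row_l (if in_co (S l).1 i j then beta 0 l else alpha 0 l).

(** Time i lies in the cyclic [a_l, i) only when a_l = i, and then row l is inactive at i. *)
Lemma switch_start i alpha beta :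
  switch i alpha beta i *m span_mx F S i = alpha *m span_mx F S i.
Proof.
apply/rowP=> l; rewrite !span_mxE mxE.
case: (boolP (in_oc (S l) i)) => [/andP[_ ia]|_]; last by rewrite !mulr0n.
case: ifP => //; move: ia; rewrite -[i == _]val_eqE /in_co /=; case: ifP; lia.
Qed.

(** The time just before i lies in every cyclic [a_l, i), also in the full circle for a_l = i. *)
Lemma switch_end i alpha beta j : ordS j = i ->
  switch i alpha beta j *m span_mx F S (ordS j) = beta *m span_mx F S (ordS j).
Proof.
move=> <-; congr (_ *m _); apply/rowP=> l; rewrite mxE.
suff -> : in_co (S l).1 (ordS j) j by [].
have := ltn_ord j; have := ltn_ord (S l).1; rewrite /in_co /=.
case: (ltnP j.+1 n) => [jn|nj ? jn].
  by rewrite modn_small //; case: ifP; lia.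
have -> : j.+1 = n by lia.
by rewrite modnn; case: ifP; lia.
Qed.

(** Away from i, membership in [a_l, i) changes only on reaching a_l, where row l is inactive. *)
Lemma switch_step i alpha beta j : ordS j != i ->
  switch i alpha beta j *m span_mx F S (ordS j) =
  switch i alpha beta (ordS j) *m span_mx F S (ordS j).
Proof.
move=> ji; apply/rowP=> l; rewrite !span_mxE !mxE.
case: (boolP (in_oc (S l) _)) => [/andP[_ ja]|_]; last by rewrite !mulr0n.
congr ((if _ then _ else _) *+ _).
move: (ji : ordS j != i :> nat) (ja : ordS j != (S l).1 :> nat).
rewrite /in_co /=.
have := ltn_ord j; have := ltn_ord (S l).1; have := ltn_ord i.
case: (ltnP j.+1 n) => [jn|nj ? ? jn].
  by rewrite modn_small //; case: ifP; lia.
have E : j.+1 = n by lia.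
by rewrite E modnn; case: ifP; lia.
Qed.

Hypothesis ker : forall (i : 'I_n) (alpha : 'rV_k),
  alpha *m bcjr_mx G H S i = 0 -> alpha *m span_mx F S i = 0.

Lemma product_trellis_non_mergeable : non_mergeable C (product_trellis G S).
Proof.
split=> [|i v1 v2 v12 mergeC]; first exact: product_trellis_represents.
have [alpha v1E] := mx_vertex_ex v1; have [beta v2E] := mx_vertex_ex v2.
pose gamma := switch i alpha beta.
pose c := \row_j (gamma j *m col j G) 0 0.
have /mergeC/HC : label_code (Defs.merge v1 v2) c.
  set T := product_trellis G S.
  pose vert j e : vertex T j := mx_vertex (span_mx F S j) e.
  have vert_i j e :
      j = i -> Tagged (vertex T) (vert j e) = Tagged (vertex T) (vert i e).
    by move->.
  (* The cycle in the merged trellis uses the new vertex at time i and the vertices of the walk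
     elsewhere. *)
  have /fin_all_exists[u uE] (j : 'I_n) : exists x : merged_vertex v1 v2 j,
      forall v, replaced_by v x <->
        if j == i then is_true (is_v12 v1 v2 v) else v = vert j (gamma j).
    case: eqVneq => [ji|ji]; first by exists (inl (exist _ tt (introT eqP ji))).
    suff N12 : ~~ is_v12 v1 v2 (vert j (gamma j)).
      by exists (inr (exist (fun v => ~~ is_v12 v1 v2 v) _ N12)).
    by apply: contra ji => /orP[] /eqP/(congr1 tag) /= ->.
  exists u => j; exists (vert j (gamma j)), (vert (ordS j) (gamma j)); split.
  - apply/uE; case: eqVneq => // ji.
    by rewrite /is_v12 (vert_i _ _ ji) v1E /vert /mx_vertex ji switch_start eqxx.
  - apply/uE; case: eqVneq => [ji|ji]; last by rewrite /vert /mx_vertex switch_step.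
    rewrite /is_v12 v2E; apply/orP; right; apply/eqP.
    rewrite -/(vert _ _) -(vert_i _ _ ji).
    by rewrite /vert /mx_vertex switch_end.
  - by exists (gamma j); rewrite !mx_vertexE mxE.
rewrite (syndrome_walk GH GS (alpha := gamma)) => [|j]; last by rewrite mxE.
(* After the shift, only the term ending at time i survives: the walk arrives there at [beta] but
   departs from [alpha]. *)
rewrite sumrB [X in _ - X](reindex_inj (@ordS_inj n)) -sumrB.
under eq_bigr do rewrite -mulmxBl.
rewrite (bigD1 (ord_pred i)) // big1 => [|j ji]; last first.
  rewrite switch_step ?subrr ?mul0mx //.
  by apply: contra_neq ji => <-; rewrite ordSK.
rewrite Monoid.mulm1 switch_end ?ord_predK // switch_start.
rewrite -mulmxBl -mulmxA bcjr_span_mx //.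
move/ker/eqP; rewrite mulmxBl subr_eq0 => /eqP E.
by apply: v12; rewrite v1E v2E /mx_vertex E.
Qed.
End ProductTrellis.

(** * Selecting rows of X, and the theorem *)

Lemma rowsub_generates (F : fieldType) (n : nat) (C : {vspace 'rV[F]_n})
    (X : 'M[F]_n) (f : 'I_(\dim C) -> 'I_n) :
  <<[seq row l X | l : 'I_n]>>%VS = C -> row_free (rowsub f X) ->
  mx_vspace (rowsub f X) = C.
Proof.
move=> XC freeG; set G := rowsub f X.
apply/eqP; rewrite eqEdim; apply/andP; split.
  apply/subvP => _ /mx_vspaceP[alpha ->]; rewrite mulmx_sum_row.
  apply: memv_suml => l _; apply: memvZ; rewrite row_rowsub -XC memv_span //.
  by apply/imageP; exists (f l).
have := limg_ker_dim (linfun (mulmxr G)) (fullv : {vspace 'rV_(\dim C)}).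
have -> : lker (linfun (mulmxr G)) = 0%VS :> {vspace 'rV_(\dim C)}.
  apply/eqP/lker0P => u v; rewrite !lfunE /=; exact: row_free_inj.
by rewrite capv0 dimv0 add0n dimvf /dim /= mul1n => ->.
Qed.

Lemma rows_basis (F : fieldType) (k n : nat) (C : {vspace 'rV[F]_n})
  (G : 'M[F]_(k, n)) : mx_vspace G = C -> \dim C = k -> generator_mx C G.
Proof.
move=> GC dimC; rewrite /generator_mx basisEdim size_image card_ord dimC.
rewrite leqnn andbT.
rewrite -GC; apply/subvP => _ /mx_vspaceP[alpha ->]; rewrite mulmx_sum_row.
by apply: memv_suml => l _; apply/memvZ/memv_span/imageP; exists l.
Qed.

(** Selection by [P] turns [alpha] into a coefficient row [alpha *m P] for all of X, to which
    [char_pair_ker] applies; [P] intertwines the two span matrices and is free, so it cancels. *)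
Lemma char_pair_rowsub_ker (F : fieldType) (n : nat) (C : {vspace 'rV[F]_n})
    (X : 'M[F]_n) (S : 'I_n -> 'I_n * 'I_n) (H : 'M[F]_(n - \dim C, n)) (k : nat)
    (f : 'I_k -> 'I_n) (i : 'I_n) (alpha : 'rV_k) :
  characteristic_pair C X S -> parity_check C H -> row_free (rowsub f X) ->
  alpha *m bcjr_mx (rowsub f X) H (fun l => S (f l)) i = 0 ->
  alpha *m span_mx F (fun l => S (f l)) i = 0.
Proof.
move=> XS HC freeG; pose P : 'M[F]_(k, n) := rowsub f 1%:M.
have freeP : row_free P.
  rewrite /row_free eqn_leq rank_leq_row -{1}(eqP freeG) rowsubE.
  exact: mxrankM_maxl.
have -> : bcjr_mx (rowsub f X) H (fun l => S (f l)) i = P *m bcjr_mx X H S i.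
  rewrite -rowsubE; apply/matrixP=> l t; rewrite !mxE !summxE; congr (_ + _).
    by apply: eq_bigr => j _; rewrite !mxE.
  by apply: eq_bigr => j _; rewrite !mxE !big_ord1 !mxE.
rewrite mulmxA => /(char_pair_ker XS HC) aP.
apply: (row_free_inj freeP); rewrite mul0mx -aP -!mulmxA; congr (_ *m _).
apply/matrixP=> l j; rewrite mul_diag_mx mul_mx_diag !mxE mulrC.
by case: eqP => [->|]; rewrite ?mul0r.
Qed.

Theorem theorem4p12 (F : finFieldType) (n k : nat) (n_gt0 : (0 < n)%N)
    (C : {vspace 'rV[F]_n}) (dimC : \dim C = k) (suppC : full_support C)
    (H : 'M[F]_(n - k, n)) (HC : parity_check C H) :
  (forall (X : 'M[F]_n) (S : 'I_n -> 'I_n * 'I_n) (f : 'I_k -> 'I_n),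
     characteristic_pair C X S ->
     row_free (rowsub f X) ->
     trellis_iso (product_trellis (rowsub f X) (fun l => S (f l)))
                 (bcjr_trellis (rowsub f X) H (fun l => S (f l)))) /\
  (forall T : lin_trellis F n,
     KV_trellis C T ->
     (exists2 T' : lin_trellis F n, BCJR_trellis C T' & trellis_iso T T') /\
     non_mergeable C T).
Proof.
subst k.
have spans (X : 'M[F]_n) S (f : 'I_(\dim C) -> 'I_n) : span_list X S ->
    span_list (rowsub f X) (fun l => S (f l)).
  by move=> XSp l; rewrite row_rowsub.
have iso (X : 'M[F]_n) S (f : 'I_(\dim C) -> 'I_n) :
    characteristic_pair C X S -> row_free (rowsub f X) ->
    trellis_iso (product_trellis (rowsub f X) (fun l => S (f l)))
                (bcjr_trellis (rowsub f X) H (fun l => S (f l))).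
  move=> XS freeG; have [XC XSp _ _] := XS.
  apply: mx_trellis_iso => i alpha; split; last exact: (char_pair_rowsub_ker XS HC).
  (* The other kernel inclusion follows from N_i = M_i N_i. *)
  have GC := rowsub_generates XC freeG.
  rewrite -(bcjr_span_mx (generator_syndrome0 GC HC) (spans _ _ _ XSp)) mulmxA => ->.
  exact: mul0mx.
split=> // T [X [S [f [XS freeG ->]]]]; have [XC XSp _ _] := XS.
have GC := rowsub_generates XC freeG.
split; last first.
  apply: (product_trellis_non_mergeable GC HC); first exact: spans.
  by move=> i alpha; apply: char_pair_rowsub_ker.
exists (bcjr_trellis (rowsub f X) H (fun l => S (f l))); last exact: iso.
exists (rowsub f X), H, (fun l => S (f l)); split=> //; last exact: spans.
exact: rows_basis.
Qed.
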